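(* Given a totally real number field $K\subset\mathbb{R}$, there is a completely algebraically periodic translation surface with periodic direction field $K$ which has a decomposition into squares.
   Context: A translation surface is a compact (connected, oriented) surface $S$ obtained by gluing finitely many polygons in $\mathbb{R}^2$ along parallel edges by translations; $\Sigma$ denotes its set of singular points. A decomposition into squares is a decomposition into finitely many Euclidean squares with disjoint interiors; the squares need not have equal side lengths and the decomposition need not be edge-to-edge. View $\mathbb{R}^2$ and $\mathbb{R}$ as $\mathbb{Q}$-vector spaces. Take an edge-to-edge decomposition of $S$ into Euclidean triangles $\Delta_j$ whose vertex set contains $\Sigma$, and let $v_j,w_j\in\mathbb{R}^2$ be two successive sides of $\Delta_j$ in counterclockwise order. The $J$-invariant is $J(S)=\sum_j v_j\wedge w_j\in\mathbb{R}^2\wedge_{\mathbb{Q}}\mathbb{R}^2$ (independent of the triangulation). For $0\ne v\in\mathbb{R}^2$ let $\pi:\mathbb{R}^2\to\mathbb{R}$ be the orthogonal projection with kernel $\mathbb{R}v$, and let $\mathrm{SAF}_v(S)\in\mathbb{R}\wedge_{\mathbb{Q}}\mathbb{R}$ be the image of $J(S)$ under the map induced by $\pi$. The direction $v$ is algebraically periodic if $\mathrm{SAF}_v(S)=0$. If $S$ has at least three algebraically periodic directions, then after a linear change of coordinates so that the directions of slopes $0,1,\infty$ are algebraically periodic, the set of finite slopes of algebraically periodic directions is a subfield of $\mathbb{R}$ (independent of the choices), called the periodic direction field of $S$. The holonomy of $S$ is the image of $\mathrm{hol}:H_1(S,\Sigma;\mathbb{Q})\to\mathbb{R}^2$, $\sigma\mapsto(\int_\sigma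 dx,\int_\sigma dy)$. A homological direction is the direction of a non-zero vector in the holonomy. $S$ is completely algebraically periodic if every homological direction is algebraically periodic. A number field is totally real if all its embeddings into $\mathbb{C}$ have image in $\mathbb{R}$. *)

(* Defs.v *)
From HB Require Import structures.
From Stdlib Require Import Relations.
From mathcomp Require Import all_boot all_order all_algebra all_field.
From mathcomp Require Import all_classical all_reals all_analysis.
From mathcomp Require Import ring_quotient complex freeg.

Set Implicit Arguments.
Unset Strict Implicit.
Unset Printing Implicit Defensive.

Import Order.TTheory GRing.Theory Num.Theory.

Local Open Scope classical_set_scope.
Local Open Scope ring_scope.
Local Open Scope quotient_scope.

(* The exterior square V /\_Q V of a real vector space V regarded as a
   Q-vector space: the free Q-vector space on V * V, modulo the Q-subspace
   generated by the relations that make (v, w) |-> v /\ w Q-bilinear and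
   alternating. *)

Section ExteriorSquare.
Variables (R : realType) (V : lmodType R).

Inductive wedge_relation : {freeg (V * V) / rat} -> Prop :=
| WedgeRel0 : wedge_relation 0
| WedgeRelB x y :
    wedge_relation x -> wedge_relation y -> wedge_relation (x - y)
| WedgeRelZ (a : rat) x : wedge_relation x -> wedge_relation (a *: x)
| WedgeRelLinl (a : rat) u v w : wedge_relation
    (<< (ratr a *: u + v, w) >> - a *: << (u, w) >> - << (v, w) >>)
| WedgeRelLinr (a : rat) u v w : wedge_relation
    (<< (w, ratr a *: u + v) >> - a *: << (w, u) >> - << (w, v) >>)
| WedgeRelAlt v : wedge_relation << (v, v) >>.

Definition wedge_rel_pred : {pred {freeg (V * V) / rat}} :=
  fun x => `[< wedge_relation x >].

Lemma wedge_rel_zmod : zmod_closed wedge_rel_pred.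
Proof.
split=> [|x y /asboolP rx /asboolP ry]; apply/asboolP; first exact: WedgeRel0.
exact: WedgeRelB.
Qed.

HB.instance Definition _ :=
  GRing.isZmodClosed.Build _ wedge_rel_pred wedge_rel_zmod.

Definition ext_square := Quotient.quot wedge_rel_pred.

Definition wedge (v w : V) : ext_square := \pi_ext_square << (v, w) >>.

End ExteriorSquare.

(* The map induced on exterior squares by f, well defined when f is Q-linear:
   see ext_square_map_pi. *)
Definition ext_square_map (R : realType) (V W : lmodType R) (f : V -> W)
    (t : ext_square V) : ext_square W :=
  \pi_(ext_square W) (fglift (fun p => << (f p.1, f p.2) >>) (repr t)).

Section ExteriorSquareTheory.
Variable R : realType.

Lemma wedge_relationP (V : lmodType R) (x y : {freeg (V * V) / rat}) :
  wedge_relation (x - y) <->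
  \pi_(ext_square V) x = \pi_(ext_square V) y.
Proof.
split=> [r|/eqP].
  by apply/eqP; rewrite -Quotient.idealrBE; apply/asboolP.
by rewrite -Quotient.idealrBE => /asboolP.
Qed.

Lemma ext_square_piB (V : lmodType R) (x y : {freeg (V * V) / rat}) :
  \pi_(ext_square V) (x - y) = \pi_(ext_square V) x - \pi_(ext_square V) y.
Proof. by rewrite !piE. Qed.

Lemma fgliftB (K : choiceType) (M : lmodType rat) (f : K -> M)
    (x y : {freeg K / rat}) :
  fglift f (x - y) = fglift f x - fglift f y.
Proof. exact: lift_is_additive. Qed.

Lemma fgliftZ (K : choiceType) (M : lmodType rat) (f : K -> M)
    (a : rat) (x : {freeg K / rat}) :
  fglift f (a *: x) = a *: fglift f x.
Proof.
pose g : {additive {freeg K / rat} -> M} := HB.pack (fglift f)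
  (GRing.isZmodMorphism.Build _ _ (fglift f) (lift_is_additive f)).
have gU k z : g << k *g z >> = k *: f z by exact: liftU.
have -> : a *: x = \sum_(z <- dom x) << a * coeff z x *g z >> by [].
rewrite -[fglift f x]/(g x) -[X in _ = _ *: g X]freeg_sumE.
rewrite -[LHS]/(g _) !raddf_sum.
by apply: eq_bigr => z _; rewrite !gU /= scalerA.
Qed.

Lemma ext_square_map_pi (V W : lmodType R) (f : V -> W) x :
  (forall (a : rat) u v, f (ratr a *: u + v) = ratr a *: f u + f v) ->
  ext_square_map f (\pi_(ext_square V) x) =
  \pi_(ext_square W) (fglift (fun p => << (f p.1, f p.2) >>) x).
Proof.
move=> flin; apply/wedge_relationP; rewrite -fgliftB.
have: wedge_relation (repr (\pi_(ext_square V) x) - x).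
  by apply/wedge_relationP; rewrite reprK.
move: (_ - x) => {x} y; elim=> [|{}y z _ IHy _ IHz|a {}y _ IHy|a u v w|a u v w|v].
- have := fgliftB (fun p => << (f p.1, f p.2) >> : {freeg (W * W) / rat}) 0 0.
  by rewrite !subrr => ->; exact: WedgeRel0.
- by rewrite fgliftB; exact: WedgeRelB.
- by rewrite fgliftZ; exact: WedgeRelZ.
- by rewrite !fgliftB fgliftZ !liftU !scale1r /= flin; exact: WedgeRelLinl.
- by rewrite !fgliftB fgliftZ !liftU !scale1r /= flin; exact: WedgeRelLinr.
- by rewrite liftU scale1r; exact: WedgeRelAlt.
Qed.

Lemma ext_square_map_wedge (V W : lmodType R) (f : V -> W) v w :
  (forall (a : rat) u v, f (ratr a *: u + v) = ratr a *: f u + f v) ->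
  ext_square_map f (wedge v w) = wedge (f v) (f w).
Proof. by move=> flin; rewrite ext_square_map_pi // liftU scale1r. Qed.

Lemma ext_square_mapB (V W : lmodType R) (f : V -> W) (s t : ext_square V) :
  (forall (a : rat) u v, f (ratr a *: u + v) = ratr a *: f u + f v) ->
  ext_square_map f (s - t) = ext_square_map f s - ext_square_map f t.
Proof.
move=> flin; rewrite -[s]reprK -[t]reprK -ext_square_piB.
by rewrite !ext_square_map_pi // fgliftB ext_square_piB.
Qed.

End ExteriorSquareTheory.

Section Plane.
Variable R : realType.
Local Notation plane := 'rV[R]_2.

Definition vec2 (x y : R) : plane := \row_j [:: x; y]`_j.

Definition det2 (u v : plane) : R := u 0 0 * v 0 1 - u 0 1 * v 0 0.

Definition dot2 (u v : plane) : R := u 0 0 * v 0 0 + u 0 1 * v 0 1.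

(* The Euclidean norm; the norm `|u| of matrices is the sup norm. *)
Definition norm2 (u : plane) : R := Num.sqrt (dot2 u u).

Definition rot90 (u : plane) : plane := vec2 (- u 0 1) (u 0 0).

Definition angle2 (u v : plane) : R := acos (dot2 u v / (norm2 u * norm2 v)).

(* Orthogonal projection onto the line orthogonal to v, identified with R by
   means of its unit vector rot90 v / norm2 v. *)
Definition orth_proj (v : plane) (x : plane) : R^o :=
  dot2 x (rot90 v) / norm2 v.

Lemma orth_proj_linear (v : plane) (a : R) x y :
  orth_proj v (a *: x + y) = a *: orth_proj v x + orth_proj v y.
Proof.
rewrite /orth_proj /dot2 !mxE /GRing.scale /= mulrA -mulrDl.
congr (_ / _); rewrite !mulrDr !mulrDl !mulrA.
by rewrite addrACA.
Qed.

(* The closed square with corner p and consecutive sides u and rot90 u, and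
   its interior. *)
Definition closed_square (p u : plane) : set plane :=
  [set x | exists a b : R, [/\ 0 <= a <= 1, 0 <= b <= 1 &
     x = p + a *: u + b *: rot90 u]].

Definition open_square (p u : plane) : set plane :=
  [set x | exists a b : R, [/\ 0 < a < 1, 0 < b < 1 &
     x = p + a *: u + b *: rot90 u]].

End Plane.

(* A translation surface, presented by the triangles of an edge-to-edge
   triangulation and the gluing of their sides: the side (t, i) of the
   triangle t runs from its corner i to its corner i + 1 (mod 3), in
   counterclockwise order, and is glued to the side glue (t, i) by the
   translation that matches them with opposite orientations. Points of the
   surface are the classes of points of the triangles; see same_point. *)
Record translation_surface (R : realType) := TranslationSurface {
  face : finType;
  corner : face -> 'I_3 -> 'rV[R]_2;
  glue : face * 'I_3 -> face * 'I_3;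
  side := fun e : face * 'I_3 => corner e.1 (ordS e.2) - corner e.1 e.2;
  face_ccw : forall t, 0 < det2 (side (t, 0)) (side (t, 1));
  glue_involutive : involutive glue;
  side_glue : forall e, side (glue e) = - side e;
  face_nonempty : (0 < #|face|)%N;
  face_connected :
    forall t t', connect [rel s s' | [exists i, (glue (s, i)).1 == s']] t t'
}.

Section TranslationSurface.
Variables (R : realType) (S : translation_surface R).
Local Notation plane := 'rV[R]_2.
Local Notation edge := (face S * 'I_3)%type.

Definition triangle (t : face S) : set plane :=
  [set x | forall i, 0 <= det2 (side (t, i)) (x - corner t i)].

(* The gluing: a point x of the side e is identified with its image in the
   triangle of glue e under the translation that takes the origin of e to the
   end of glue e. *)
Definition glue_point (p q : face S * plane) : Prop :=
  exists (e : edge) (l : R),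
    [/\ 0 <= l <= 1,
        p = (e.1, corner e.1 e.2 + l *: side e) &
        q = ((glue e).1,
             corner (glue e).1 (ordS (glue e).2) + l *: side e)].

Definition same_point : face S * plane -> face S * plane -> Prop :=
  clos_refl_sym_trans _ glue_point.

(* The point of the surface represented by the point x of the triangle t. *)
Definition chart (t : face S) (x : plane) : set (face S * plane) :=
  [set q | same_point (t, x) q].

Definition surface_point : set (set (face S * plane)) :=
  [set s | exists t x, triangle t x /\ s = chart t x].

(* J-invariant and SAF-invariants *)

Definition J_invariant : ext_square plane :=
  \sum_(t : face S) wedge (side (t, 0)) (side (t, 1)).

Definition SAF (v : plane) : ext_square R^o :=
  ext_square_map (orth_proj v) J_invariant.

Lemma SAF_sum (v : plane) :
  SAF v = \sum_(t : face S)
    wedge (orth_proj v (side (t, 0))) (orth_proj v (side (t, 1))).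
Proof.
have lin (a : rat) x y : orth_proj v (ratr a *: x + y) =
    ratr a *: orth_proj v x + orth_proj v y by exact: orth_proj_linear.
pose F t := ext_square_map (orth_proj v) t.
have F0 : F 0 = 0 by rewrite -(subrr 0) /F ext_square_mapB // subrr.
have FD : {morph F : x y / x + y}.
  move=> x y; rewrite -{1}[y]opprK -[- y]add0r /F !ext_square_mapB //.
  by rewrite [ext_square_map _ 0]F0 sub0r opprK.
rewrite /SAF /J_invariant -/(F _) (big_morph F FD F0).
by apply: eq_bigr => t _; rewrite /F ext_square_map_wedge.
Qed.

Definition algebraically_periodic (v : plane) : Prop :=
  v != 0 /\ SAF v = 0.

(* The vector of slope s, resp. of infinite slope, in the linear coordinates
   x |-> x *m g. *)
Definition slope_vector (g : 'M[R]_2) (s : R) : plane :=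
  vec2 1 s *m invmx g.
Definition vertical_vector (g : 'M[R]_2) : plane :=
  vec2 0 1 *m invmx g.

Definition periodic_slopes (g : 'M[R]_2) : set R :=
  [set s | algebraically_periodic (slope_vector g s)].

Definition is_periodic_direction_field (k : set R) : Prop :=
  (exists u v w : plane,
     [/\ algebraically_periodic u, algebraically_periodic v &
         algebraically_periodic w] /\
     [/\ det2 u v != 0, det2 v w != 0 & det2 u w != 0]) /\
  (forall g : 'M[R]_2, g \in unitmx ->
     algebraically_periodic (slope_vector g 0) ->
     algebraically_periodic (slope_vector g 1) ->
     algebraically_periodic (vertical_vector g) ->
     periodic_slopes g = k).

(* Vertices are the orbits of next_corner on the corners of the triangles;
   next_corner turns around a vertex, from one corner to the adjacent one. *)
Definition next_corner (c : edge) : edge :=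
  ((glue c).1, ordS (glue c).2).

Definition same_vertex : rel edge := fconnect next_corner.

Definition corner_angle (c : edge) : R :=
  angle2 (side c) (corner c.1 (ord_pred c.2) - corner c.1 c.2).

Definition cone_angle (c : edge) : R :=
  \sum_(d | same_vertex c d) corner_angle d.

Definition singular (c : edge) : Prop := cone_angle c != 2 * pi.

(* Relative homology H_1(S, Sigma; Q) is computed from the simplicial chains of
   the triangulation. A chain is a rational combination of the oriented sides,
   glue e being identified with - e; passing to the quotient by this
   identification and by boundaries does not change the image of holonomy. *)
Definition boundary (c : edge -> rat) (d : edge) : rat :=
  \sum_(e | same_vertex d (e.1, ordS e.2)) c e -
  \sum_(e | same_vertex d e) c e.

Definition relative_cycle (c : edge -> rat) : Prop :=
  forall d, ~ singular d -> boundary c d = 0.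

Definition holonomy : set plane :=
  [set v | exists2 c : edge -> rat, relative_cycle c &
     v = \sum_(e : edge) ratr (c e) *: side e].

Definition completely_algebraically_periodic : Prop :=
  forall v, holonomy v -> v != 0 -> algebraically_periodic v.

(* f maps the planar region D to the surface by finitely many translates of
   triangles: the piece (t, a) is the translate by a of the triangle t. As the
   pieces agree in the surface where they meet, f is continuous, and it is a
   local translation in the interior of D. *)
Definition translation_map (D : set plane)
    (f : plane -> set (face S * plane)) : Prop :=
  exists P : seq (face S * plane),
    (forall x, D x -> exists2 m, m \in P & triangle m.1 (x - m.2)) /\
    (forall x m, D x -> m \in P -> triangle m.1 (x - m.2) ->
       f x = chart m.1 (x - m.2)).

Definition decomposes_into_squares : Prop :=
  exists (n : nat) (p u : 'I_n -> plane)
         (f : 'I_n -> plane -> set (face S * plane)),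
    [/\ forall k, u k != 0,
        forall k, translation_map (closed_square (p k) (u k)) (f k),
        forall s, surface_point s ->
          exists k x, closed_square (p k) (u k) x /\ f k x = s &
        forall k k' x x',
          open_square (p k) (u k) x -> open_square (p k') (u k') x' ->
          f k x = f k' x' -> k = k' /\ x = x'].

End TranslationSurface.

Definition totally_real (R : realType) (K : fieldExtType rat) : Prop :=
  forall (sigma : {rmorphism K -> R[i]}) (x : K), sigma x \is Num.real.

(* Main.v *)
(* Since K is totally real, T(x) = Tr(x) satisfies T(x^2) > 0 for x <> 0:
   multiplication by a primitive element is diagonalizable over R, so T(x^2) is
   a sum of squares of real eigenvalues. Gram-Schmidt over Q then yields
   finitely many a in K, positive in R, with x = sum_a T(x a) a for all x; in
   other words sum_a a (x) a commutes with the multiplication by elements of K.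
   Take the squares of sides a with opposite sides identified, and join these
   tori in a cycle along horizontal slits of a common length eps in K. In the
   direction of slope s the SAF-invariant is, up to a real scaling,
   2 sum_a (s a) /\ a. It vanishes when s is in K, as sum_a (s a) (x) a is then
   symmetric. When s is not in K, Zorn's lemma provides K-linear maps
   phi, psi : R -> K dual to s and 1, and the alternating form
   T (phi x * psi y - psi x * phi y) takes the value 2 sum_a T(a^2) > 0. *)

Require Import Defs.
From HB Require Import structures.
From Stdlib Require Import Relations.
From mathcomp Require Import all_boot all_order all_algebra all_field.
From mathcomp Require Import all_classical all_reals.
From mathcomp Require Import ring lra ring_quotient complex freeg.

Set Implicit Arguments.
Unset Strict Implicit.
Unset Printing Implicit Defensive.

Import Order.TTheory GRing.Theory Num.Theory.

Local Open Scope classical_set_scope.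
Local Open Scope ring_scope.

(** * Positivity of the trace form *)

(** Each x in K is q(theta) for some polynomial q, and sigma sends it to q(z). Two choices of q
    differ by a multiple of the minimal polynomial, which vanishes at z, so the value depends on x
    alone. *)
Lemma embedding_of_root (F L : fieldType) (K : fieldExtType F) (theta : K)
    (p : {poly F}) (f : {rmorphism F -> L}) (z : L) :
    <<1; theta>>%VS = fullv ->
    minPoly 1 theta = map_poly (in_alg K) p ->
    root (map_poly f p) z ->
  exists sigma : {rmorphism K -> L}, sigma theta = z.
Proof.
move=> gen def_p pz.
have exq (x : K) : {q | x = (map_poly (in_alg K) q).[theta]}.
  apply/cid/Fadjoin1_polyP; first by rewrite gen memvf.
pose sigma x := (map_poly f (sval (exq x))).[z].
have sigmaE q : sigma (map_poly (in_alg K) q).[theta] = (map_poly f q).[z].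
  rewrite /sigma; case: (exq _) => r /= /eqP.
  rewrite eq_sym -subr_eq0 -hornerN -hornerD -rmorphB /= => rq.
  have: minPoly 1 theta %| map_poly (in_alg K) (r - q).
    by apply: minPoly_dvdp rq; apply/polyOver1P; exists (r - q).
  rewrite def_p dvdp_map => /dvdpP[t /(congr1 (map_poly f))].
  rewrite rmorphB rmorphM /= => /(congr1 (fun u => u.[z])).
  rewrite hornerM (rootP pz) mulr0 hornerD hornerN => /eqP.
  by rewrite subr_eq0 => /eqP.
have xE x := svalP (exq x).
have sB : zmod_morphism sigma.
  move=> x y; rewrite [x in LHS]xE [y in LHS]xE -hornerN -hornerD -rmorphB.
  by rewrite !sigmaE rmorphB hornerD hornerN.
have sM : monoid_morphism sigma.
  split=> [|x y].
    by have := sigmaE 1; rewrite !rmorph1 !hornerC.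
  rewrite [x in LHS]xE [y in LHS]xE -hornerM -rmorphM.
  by rewrite !sigmaE rmorphM hornerM.
pose s : {rmorphism K -> L} := HB.pack sigma
  (GRing.isZmodMorphism.Build _ _ sigma sB)
  (GRing.isMonoidMorphism.Build _ _ sigma sM).
by exists s; have := sigmaE 'X; rewrite !map_polyX !hornerX.
Qed.

Lemma split_real_poly (R : rcfType) (p : {poly R}) : p \is monic ->
    (forall z : R[i], root (map_poly (real_complex R) p) z -> z \is Num.real) ->
  exists rs : seq R, p = \prod_(r <- rs) ('X - r%:P).
Proof.
move=> p_monic real_roots.
have [rs def_p] := closed_field_poly_normal (map_poly (real_complex R) p).
move: def_p; rewrite (monicP _) ?map_monic // scale1r => def_p.
exists (map (@complex.Re R) rs); apply: (map_poly_inj (real_complex R)).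
rewrite def_p rmorph_prod big_map /=; apply: eq_big_seq => z z_rs.
rewrite rmorphB /= map_polyX map_polyC /= RRe_real ?real_roots // def_p.
by rewrite root_prod_XsubC.
Qed.

(** Conjugation preserves the trace, so the trace of A^2 is the sum of the squares of the
    eigenvalues [d]. *)
Lemma trace_diag_conj_sqr (R : realFieldType) n (P : 'M[R]_n.+1) (d : 'rV_n.+1)
    (A := invmx P *m diag_mx d *m P) :
  P \in unitmx -> 0 <= \tr (A *m A) ?= iff (A == 0).
Proof.
move=> uP.
have -> : A *m A = invmx P *m diag_mx (map_mx (fun x => x ^+ 2) d) *m P.
  rewrite /A !mulmxA mulmxK // -!mulmxA (mulmxA (diag_mx d)); congr (_ *m (_ *m _)).
  by apply/matrixP=> i j; rewrite mul_diag_mx !mxE expr2 mulrnAr.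
rewrite mxtrace_mulC mulmxA mulmxV // mul1mx mxtrace_diag.
under eq_bigr do rewrite mxE.
split; first by apply: sumr_ge0 => i _; exact: sqr_ge0.
rewrite eq_sym psumr_eq0 => [|i _]; last exact: sqr_ge0.
apply/idP/eqP => [/allP d0|A0]; last apply/allP => i _.
  suff d0' : d = 0 by rewrite /A d0' linear0 mulmx0 mul0mx.
  apply/rowP=> i; rewrite mxE; apply/eqP.
  by have := d0 i (mem_index_enum _); rewrite /= sqrf_eq0.
have : P *m A *m invmx P = 0 by rewrite A0 mulmx0 mul0mx.
rewrite /A !mulmxA mulmxV // mul1mx mulmxK // => /matrixP/(_ i i).
by rewrite !mxE eqxx mulr1n => ->; rewrite /= expr0n.
Qed.

(** * The regular representation of a finite extension *)

Section RegularRepresentation.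
Variables (F : fieldType) (K : fieldExtType F) (n : nat) (b : n.+1.-tuple K).
Hypothesis b_basis : basis_of fullv b.

(** Matrices act on row vectors of coordinates, which reverses products; as K is commutative,
    [mulmat] is multiplicative all the same. *)
Definition mulmat (x : K) : 'M[F]_n.+1 := \matrix_(i, j) coord b j (x * b`_i).

Lemma mulmat_is_linear : linear mulmat.
Proof.
by move=> a x y; apply/matrixP=> i j; rewrite !mxE mulrDl -scalerAl linearP.
Qed.

HB.instance Definition _ :=
  GRing.isLinear.Build F K 'M[F]_n.+1 _ mulmat mulmat_is_linear.

Lemma mulmatE (x : K) (i : 'I_n.+1) :
  x * b`_i = \sum_(j < n.+1) mulmat x i j *: b`_j.
Proof.
rewrite {1}(coord_basis b_basis (memvf (x * b`_i))).
by apply: eq_bigr => j _; rewrite mxE.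
Qed.

Lemma mulmatM (x y : K) : mulmat (x * y) = mulmat x *m mulmat y.
Proof.
apply/matrixP=> i k; rewrite mxE [RHS]mxE (mulrC x) -mulrA mulmatE.
rewrite mulr_sumr linear_sum.
apply: eq_bigr => j _.
by rewrite -scalerAr linearZ [mulmat y _ _]mxE.
Qed.

Lemma mulmat1 : mulmat 1 = 1%:M.
Proof.
apply/matrixP=> i j; rewrite !mxE mul1r coord_free 1?eq_sym //.
by case/andP: b_basis.
Qed.

Lemma mulmat_inj : injective mulmat.
Proof.
apply: raddf_inj => x Mx0; have := mulmatE x 0.
rewrite Mx0 big1 => [/eqP|j _]; last by rewrite mxE scale0r.
rewrite mulf_eq0 => /orP[/eqP // | /eqP b0].
have /free_not0 := basis_free b_basis.
by move=> /(_ b`_0); rewrite mem_nth ?size_tuple // b0 eqxx => /(_ isT).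
Qed.

(** Serves to show that the minimal polynomial of x annihilates its matrix, and that the matrix of
    q(x) is a polynomial in that of x. *)
Lemma horner_mulmat (x : K) (p : {poly F}) :
  horner_mx (mulmat x) p = mulmat (map_poly (in_alg K) p).[x].
Proof.
elim/poly_ind: p => [|p c IHp]; first by rewrite !rmorph0 horner0 linear0.
rewrite !rmorphD !rmorphM /= horner_mx_X horner_mx_C map_polyX map_polyC /=.
rewrite hornerMXaddC linearD /= mulmatM -IHp; congr (_ + _).
by rewrite linearZ /= mulmat1 scalemx1.
Qed.

End RegularRepresentation.

Lemma totally_real_trace_form (R : realType) (K : fieldExtType rat) :
    totally_real R K ->
  exists T : {scalar K}, forall x, x != 0 -> 0 < T (x * x).
Proof.
move=> realK; have dimK := adim_gt0 {:K}%AS.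
have [n [b b_basis]] : exists n (b : n.+1.-tuple K), basis_of fullv b.
  case: (\dim {:K}) dimK (vbasis {:K}) (vbasisP {:K}) => // n _ b b_basis.
  by exists n, b.
pose M := mulmat b.
have T_lin : scalar (fun x => \tr (M x)).
  by move=> a x y; rewrite /M linearP /= mxtraceD mxtraceZ.
pose T : {scalar K} := HB.pack (fun x => \tr (M x))
  (GRing.isLinear.Build _ _ _ _ _ T_lin).
exists T => x x_neq0.
have [theta gen] : exists theta : K, <<1; theta>>%VS = fullv.
  exists (separable_generator 1 {:K}).
  rewrite -eq_adjoin_separable_generator ?sub1v //.
  apply/separableP=> u _; apply: pcharf0_separable.
  exact: (ftrans (pchar_lalg K) (pchar_num _)).
have /polyOver1P[p def_p] := minPolyOver 1 theta.
have p_monic : p \is monic by rewrite -(map_monic (in_alg K)) -def_p monic_minPoly.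
pose f : {rmorphism rat -> R} := ratr.
(* Each complex root of p is the image of theta under an embedding of K, hence real, so p splits
   over R. *)
have [||rs def_pf] := @split_real_poly R (map_poly f p).
- by rewrite map_monic.
- move=> z; rewrite -map_poly_comp => pz.
  have [sigma <-] :=
    @embedding_of_root _ _ _ _ _ (real_complex R \o f) z gen def_p pz.
  exact: realK.
(* In characteristic 0 minimal polynomials are separable; distinct roots make the matrix of theta
   diagonalizable. *)
have uniq_rs : uniq rs.
  rewrite -separable_prod_XsubC -def_pf separable_map.
  rewrite -(separable_map (in_alg K)) -def_p.
  apply: pcharf0_separable; exact: (ftrans (pchar_lalg K) (pchar_num _)).
have : diagonalizable (map_mx f (M theta)).
  apply/diagonalizableP; exists rs => //; rewrite -def_pf; apply: mxminpoly_min.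
  rewrite -map_horner_mx horner_mulmat // -def_p (rootP (root_minPoly _ _)).
  by rewrite (raddf0 (mulmat b)) map_mx0.
case=> P uP /(diagonalizable_forLR uP)[d].
rewrite mxpoly.conjVmx // => MD.
(* As x is a polynomial in theta, the matrix P that diagonalizes [M theta] also diagonalizes
   [M x]. *)
have [q def_x] : exists q, x = (map_poly (in_alg K) q).[theta].
  by apply/Fadjoin1_polyP; rewrite gen memvf.
have MxE : map_mx f (M x) =
    invmx P *m diag_mx (map_mx (horner (map_poly f q)) d) *m P.
  rewrite {1}def_x /M -horner_mulmat // map_horner_mx MD.
  by rewrite horner_mx_uconjC // horner_mx_diag.
have [ge0 eq0] := trace_diag_conj_sqr (map_mx (horner (map_poly f q)) d) uP.
have TE : f (T (x * x)) = \tr (map_mx f (M x) *m map_mx f (M x)).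
  by rewrite -map_mxM /M -mulmatM // -trace_map_mx.
rewrite -(ltr0q R) -[ratr _]/(f _) TE MxE lt_def ge0 eq_sym eq0 -MxE andbT.
rewrite map_mx_eq0; apply: contra x_neq0 => /eqP Mx0; apply/eqP.
by apply: (mulmat_inj b_basis); rewrite linear0.
Qed.

(** * Squares representing the trace form *)

Section TraceForm.
Variables (K : fieldExtType rat) (T : {scalar K}).
Hypothesis T_pos : forall x, x != 0 -> 0 < T (x * x).

(** For nonzero, pairwise orthogonal members of E, this is the orthogonal projection onto their span
    for the form [T (x * y)]. *)
Definition gram_proj (E : seq K) (x : K) : K :=
  \sum_(e <- E) (T (x * e) / T (e * e)) *: e.

Lemma gram_projD E : {morph gram_proj E : x y / x + y}.
Proof.
move=> x y; rewrite -big_split /=; apply: eq_bigr => e _.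
by rewrite mulrDl linearD /= mulrDl scalerDl.
Qed.

Lemma gram_projZ E a : {morph gram_proj E : x / a *: x}.
Proof.
move=> x; rewrite [RHS]scaler_sumr; apply: eq_bigr => e _.
by rewrite -scalerAl linearZ /= -mulrA scalerA.
Qed.

Lemma gram_proj_sym E x y : T (gram_proj E x * y) = T (x * gram_proj E y).
Proof.
rewrite mulr_suml mulr_sumr !linear_sum; apply: eq_bigr => e _.
rewrite -scalerAl -scalerAr !linearZ /= [y * e]mulrC.
by rewrite mulrAC [RHS]mulrAC [T (x * e) * _]mulrC.
Qed.

(* That [gram_proj E] fixes [E] amounts to the orthogonality of [E]. *)
Lemma gram_schmidt (X : seq K) : exists E : seq K,
  {in E, forall e, e != 0 /\ gram_proj E e = e} /\
  {in X, forall x, gram_proj E x = x}.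
Proof.
elim: X => [|x X [E [E_ok X_ok]]]; first by exists [::].
pose x' := x - gram_proj E x.
have [/eqP|x'_neq0] := eqVneq x' 0.
  rewrite subr_eq0 => /eqP Ex; exists E; split=> // y.
  by rewrite inE => /predU1P[-> | /X_ok].
(* By self-adjointness of the projection, x' is orthogonal to all its fixed points. *)
have x'E y : gram_proj E y = y -> T (y * x') = 0.
  move=> Ey; rewrite mulrBr linearB /= -gram_proj_sym Ey.
  exact: subrr.
have Ex' : gram_proj E x' = 0.
  rewrite [LHS]big1_seq // => e /andP[_ /E_ok[_ Ee]].
  by rewrite [x' * e]mulrC x'E // mul0r scale0r.
have projE y : gram_proj (x' :: E) y =
    (T (y * x') / T (x' * x')) *: x' + gram_proj E y.
  by rewrite /gram_proj big_cons.
have fixE y : gram_proj E y = y -> gram_proj (x' :: E) y = y.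
  by move=> Ey; rewrite projE Ey x'E // mul0r scale0r add0r.
have Tx' : T (x' * x') != 0 by rewrite gt_eqF ?T_pos.
exists (x' :: E); split=> y; rewrite inE => /predU1P[-> |].
- by split=> //; rewrite projE Ex' addr0 divff // scale1r.
- by move=> /E_ok[? ?]; split=> //; exact: fixE.
(* The coefficient of x' in the projection of x is 1, because x - x' is orthogonal to x'. *)
- rewrite projE; have -> : T (x * x') = T (x' * x').
    have {1}-> : x = x' + gram_proj E x by rewrite subrK.
    by rewrite mulrDl linearD /= gram_proj_sym Ex' mulr0 linear0 addr0.
  by rewrite divff // scale1r subrK.
- by move=> /X_ok/fixE.
Qed.

(* The weight [q = m / n] of [e] is absorbed by replacing [e] with [m * n]
   copies of [e / n], up to sign. *)
Lemma scaled_copies (R : realDomainType) (iota : {rmorphism K -> R}) (e : K)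
    (q : rat) : e != 0 -> 0 < q ->
  exists A : seq K, {in A, forall a, 0 < iota a} /\
    forall x, (T (x * e) * q) *: e = \sum_(a <- A) T (x * a) *: a.
Proof.
move=> e_neq0 q_gt0.
(* The left-hand side of the identity does not change when e is replaced with - e. *)
wlog e_gt0 : e e_neq0 / 0 < iota e.
  move=> IH; have [|e_le0] := ltP 0 (iota e); first exact: IH.
  have [||A [A_gt0 A_sum]] := IH (- e); first by rewrite oppr_eq0.
    by rewrite rmorphN oppr_gt0 lt_neqAle fmorph_eq0 e_neq0.
  exists A; split=> // x; rewrite -A_sum.
  by rewrite mulrN (raddfN T) mulNr scalerN scaleNr opprK.
pose d : rat := (denq q)%:~R; have d_gt0 : 0 < d by rewrite ltr0z denq_gt0.
have [m num_q] : exists m : nat, numq q = m.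
  by exists `|numq q|%N; rewrite gez0_abs // ltW // numq_gt0.
have [n den_q] : exists n : nat, denq q = n.
  by exists `|denq q|%N; rewrite gez0_abs // ltW // denq_gt0.
have dE : d = n%:R by rewrite /d den_q.
have n_gt0 : (0 < n)%N by rewrite -ltz_nat -den_q denq_gt0.
exists (nseq (m * n) (d^-1 *: e)); split=> [a /nseqP[-> _]|x].
  rewrite -(pmulrn_lgt0 _ n_gt0) -rmorphMn -scaler_nat scalerA -dE.
  by rewrite divff ?scale1r // lt0r_neq0.
rewrite big_nseq iter_addr_0.
rewrite -scaler_nat -scalerAr [T (_ *: _)]linearZ /= !scalerA; congr (_ *: _).
have -> : q = m%:R / d by rewrite -[LHS]divq_num_den /d num_q.
rewrite natrM -dE.
field; exact: lt0r_neq0.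
Qed.

(* The sum of the [a (x) a] is the Casimir element of the trace form. *)
Lemma casimir_squares (R : realDomainType) (iota : {rmorphism K -> R}) :
  exists A : seq K, {in A, forall a, 0 < iota a} /\
    forall x, x = \sum_(a <- A) T (x * a) *: a.
Proof.
have [E [E_ok X_ok]] := gram_schmidt (vbasis {:K}).
have projE x : gram_proj E x = x.
  rewrite (coord_vbasis (memvf x)) (big_morph _ (gram_projD E) (_ : _ = 0)).
    apply: eq_bigr => i _; rewrite gram_projZ X_ok //.
    by rewrite mem_nth ?size_tuple.
  by rewrite -(scale0r 0) gram_projZ !scale0r.
(* The projection is now the identity; its terms, with weights [(T (e * e))^-1 > 0], are turned into
   copies one e at a time. *)
suff [A [A_gt0 A_sum]] : exists A : seq K, {in A, forall a, 0 < iota a} /\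
    forall x, gram_proj E x = \sum_(a <- A) T (x * a) *: a.
  by exists A; split=> // x; rewrite -A_sum projE.
have {projE X_ok}: {in E, forall e, e != 0} by move=> e /E_ok[].
rewrite /gram_proj; elim: E {E_ok} => [_|e E IH E_neq0].
  by exists [::]; split=> // x; rewrite !big_nil.
have [|A [A_gt0 A_sum]] := IH.
  by move=> y yE; apply: E_neq0; rewrite inE yE orbT.
have e_neq0 : e != 0 by rewrite E_neq0 ?mem_head.
have [|B [B_gt0 B_sum]] := @scaled_copies _ iota e (T (e * e))^-1 e_neq0.
  by rewrite invr_gt0 T_pos.
exists (B ++ A); split=> [a|x].
  by rewrite mem_cat => /orP[/B_gt0|/A_gt0].
by rewrite big_cons big_cat /= B_sum A_sum.
Qed.

End TraceForm.

(** * Exterior squares *)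

(** A K-subspace A of L that is maximal among those avoiding the coset v + K u contains u and is a
    complement of the line K v. Then phi is the coordinate along v. *)
Lemma separating_functional (K L : fieldType) (iota : {rmorphism K -> L})
    (u v : L) : (forall k, v != iota k * u) ->
  exists phi : L -> K,
    [/\ forall k x y, phi (iota k * x + y) = k * phi x + phi y,
        phi u = 0 & phi v = 1].
Proof.
move=> uv.
(* The empty set satisfies [P], as the empty chain in Zorn's lemma requires; this is why [ext]
   provides for w = 0 separately. *)
pose subspace (W : set L) := forall k x y, W x -> W y -> W (iota k * x + y).
pose P (W : set L) := subspace W /\ forall k, ~ W (v + iota k * u).
have [F FP Ftot|A [[A_sub A_uv] A_max]] := @Zorn_bigcup L P.
  split=> [k x y [X FX Xx] [Y FY Yy]|k [X FX]]; last by have [_] := FP X FX; apply.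
  by case: (Ftot X Y FX FY) => [XY|YX]; [exists Y|exists X] => //;
    [have [YS _] := FP Y FY|have [XS _] := FP X FX]; auto.
pose ext x : set L :=
  [set z | exists w k, (A w \/ w = 0) /\ z = w + iota k * x].
have ext_sub x : subspace (ext x).
  move=> k _ _ [w [l [Aw ->]]] [w' [l' [Aw' ->]]].
  exists (iota k * w + w'), (k * l + l').
  split; last by rewrite rmorphD rmorphM; ring.
  case: Aw Aw' => [Aw|->] [Aw'|->]; rewrite ?mulr0 ?add0r ?addr0; auto.
  have A0 : A 0 by have := A_sub (-1) _ _ Aw Aw; rewrite rmorphN1 mulN1r addNr.
  by left; have := A_sub k _ _ Aw A0; rewrite addr0.
have extP x : (forall k, ~ ext x (v + iota k * u)) -> A x.
  move=> ext_uv; apply: contrapT => Ax.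
  apply: (A_max (ext x)) => //; split=> [w Aw|sub].
    by exists w, 0; split; [left|rewrite rmorph0 mul0r addr0].
  by apply/Ax/sub; exists 0, 1; split; [right|rewrite rmorph1 mul1r add0r].
(* The coset is stable under translation by multiples of u, so adjoining u cannot make A meet it. *)
have Au : A u.
  apply: extP => k [w [l [Aw /esym/(canRL (addrK _))]]].
  rewrite -addrA -mulrBl -rmorphB => def_w.
  case: Aw => [|w0]; first by rewrite def_w; exact: A_uv.
  have /eqP := uv (l - k); apply.
  by apply/eqP; rewrite -subr_eq0 -mulNr -rmorphN opprB -def_w w0.
have A0 : A 0 by have := A_sub (-1) _ _ Au Au; rewrite rmorphN1 mulN1r addNr.
have A_scale k x : A x -> A (iota k * x).
  by move=> Ax; have := A_sub k _ _ Ax A0; rewrite addr0.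
have A_add x y : A x -> A y -> A (x + y).
  by move=> Ax Ay; have := A_sub 1 _ _ Ax Ay; rewrite rmorph1 mul1r.
have A_opp x : A x -> A (- x) by move=> /(A_scale (-1)); rewrite rmorphN1 mulN1r.
have Av : ~ A v by have := A_uv 0; rewrite rmorph0 mul0r addr0.
(* If x is not in A, then adjoining x makes A meet the coset: v + k u = w + l x with l nonzero,
   whence x is l^-1 v modulo A. *)
have exk x : exists k, A (x - iota k * v).
  have [Ax|Ax] := pselect (A x); first by exists 0; rewrite rmorph0 mul0r subr0.
  have /existsNP[k /contrapT[w [l [Aw vE]]]] := contra_not (extP x) Ax.
  have {}Aw : A w by case: Aw => [|->].
  have l_neq0 : l != 0.
    apply/eqP=> l0; apply: (A_uv k).
    by rewrite vE l0 rmorph0 mul0r addr0.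
  exists l^-1; have -> : x - iota l^-1 * v = iota l^-1 * (iota k * u - w).
    have -> : x = iota l^-1 * (v + iota k * u - w).
      by rewrite vE addrC addKr fmorphV mulKf // fmorph_eq0.
    by ring.
  by auto.
have unik x k l : A (x - iota k * v) -> A (x - iota l * v) -> k = l.
  move=> Ak Al; apply/eqP; rewrite -subr_eq0; apply: contra_notT Av => kl.
  have := A_scale (k - l)^-1 _ (A_add _ _ Al (A_opp _ Ak)).
  have -> : x - iota l * v - (x - iota k * v) = iota (k - l) * v.
    by rewrite rmorphB; ring.
  by rewrite fmorphV mulKf // fmorph_eq0.
pose phi x := sval (cid (exk x)).
have phiP x : A (x - iota (phi x) * v) by rewrite /phi; case: (cid _).
exists phi; split=> [k x y||].
- apply: unik (phiP _) _.
  have -> : iota k * x + y - iota (k * phi x + phi y) * v =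
      iota k * (x - iota (phi x) * v) + (y - iota (phi y) * v).
    by rewrite rmorphD rmorphM; ring.
  exact: A_sub.
- by apply: unik (phiP _) _; rewrite rmorph0 mul0r subr0.
- by apply: unik (phiP _) _; rewrite rmorph1 mul1r subrr.
Qed.

Section Wedge.
Variables (R : realType) (V : lmodType R).

Lemma ext_square_piD (x y : {freeg (V * V) / rat}) :
  \pi_(ext_square V)%qT (x + y) = \pi_(ext_square V)%qT x + \pi_(ext_square V)%qT y.
Proof. by rewrite !piE. Qed.

Lemma ext_square_pi0 : \pi_(ext_square V)%qT 0 = (0 : ext_square V).
Proof. by rewrite -(subrr 0) ext_square_piB subrr. Qed.

Lemma wedgeDl (u v w : V) : wedge (u + v) w = wedge u w + wedge v w.
Proof.
rewrite /wedge -ext_square_piD; apply/wedge_relationP.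
have := WedgeRelLinl (1 : rat) u v w.
by rewrite rmorph1 !scale1r -addrA -opprD.
Qed.

Lemma wedgeDr (u v w : V) : wedge w (u + v) = wedge w u + wedge w v.
Proof.
rewrite /wedge -ext_square_piD; apply/wedge_relationP.
have := WedgeRelLinr (1 : rat) u v w.
by rewrite rmorph1 !scale1r -addrA -opprD.
Qed.

Lemma wedge0l (w : V) : wedge 0 w = 0.
Proof. by apply: (addIr (wedge 0 w)); rewrite -wedgeDl !add0r. Qed.

Lemma wedge0r (w : V) : wedge w 0 = 0.
Proof. by apply: (addIr (wedge w 0)); rewrite -wedgeDr !add0r. Qed.

Lemma wedgeNl (u w : V) : wedge (- u) w = - wedge u w.
Proof. by apply/eqP; rewrite -addr_eq0 -wedgeDl addNr wedge0l. Qed.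

Lemma wedgeNr (u w : V) : wedge w (- u) = - wedge w u.
Proof. by apply/eqP; rewrite -addr_eq0 -wedgeDr addNr wedge0r. Qed.

Lemma wedgevv (v : V) : wedge v v = 0.
Proof.
rewrite -ext_square_pi0; apply/wedge_relationP.
by rewrite subr0; exact: WedgeRelAlt.
Qed.

Lemma wedgeC (u v : V) : wedge u v = - wedge v u.
Proof.
have := wedgevv (u + v).
by rewrite wedgeDl !wedgeDr !wedgevv add0r addr0 => /eqP; rewrite addr_eq0 => /eqP.
Qed.

(** Both sides equal the class of [a *: << (u, v) >>]; rational scalars are thus moved between the
    factors. *)
Lemma wedgeZlr (a : rat) (u v : V) :
  wedge (ratr a *: u) v = wedge u (ratr a *: v).
Proof.
transitivity (\pi_(ext_square V)%qT (a *: << (u, v) >>)).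
  rewrite -[RHS]addr0 -(wedge0l v) -[ratr a *: u]addr0 -ext_square_piD.
  by apply/wedge_relationP; rewrite opprD addrA; exact: WedgeRelLinl.
symmetry.
rewrite -[RHS]addr0 -(wedge0r u) -[ratr a *: v]addr0 -ext_square_piD.
by apply/wedge_relationP; rewrite opprD addrA; exact: WedgeRelLinr.
Qed.

Lemma wedge_suml (I : Type) (r : seq I) (F : I -> V) w :
  wedge (\sum_(i <- r) F i) w = \sum_(i <- r) wedge (F i) w.
Proof.
apply: (big_morph (fun u => wedge u w)); last exact: wedge0l.
by move=> u v; exact: wedgeDl.
Qed.

(** An alternating Q-bilinear form extends linearly to the free module and kills the relations; it
    can therefore certify that an element of the exterior square is nonzero. *)
Lemma wedge_sum_eq0 (B : V -> V -> rat)
    (Bl : forall a u v w, B (ratr a *: u + v) w = a * B u w + B v w)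
    (Br : forall a u v w, B w (ratr a *: u + v) = a * B w u + B w v)
    (Bvv : forall v, B v v = 0)
    (I : Type) (r : seq I) (x y : I -> V) :
  \sum_(i <- r) wedge (x i) (y i) = 0 -> \sum_(i <- r) B (x i) (y i) = 0.
Proof.
pose g : {freeg (V * V) / rat} -> rat^o := fglift (fun p => B p.1 p.2 : rat^o).
have gU p : g << p >> = B p.1 p.2 by rewrite /g liftU scale1r.
have g0 : g 0 = 0 by rewrite -(subrr 0) [LHS]fgliftB subrr.
have gD : {morph g : z t / z + t}.
  move=> z t; rewrite -{1}[t]opprK [LHS]fgliftB -/(g _) -/(g _).
  by rewrite -[- t]add0r [X in _ - X]fgliftB -!/(g _) g0 sub0r opprK.
have g_rel z : wedge_relation z -> g z = 0.
  elim=> [//|{}z t _ gz _ gt|a {}z _ gz|a u v w|a u v w|v].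
  - by rewrite [LHS]fgliftB -!/(g _) gz gt subrr.
  - by rewrite [LHS]fgliftZ -!/(g _) gz scaler0.
  - rewrite [LHS]fgliftB fgliftB fgliftZ -!/(g _) !gU /= Bl.
    by rewrite /GRing.scale /=; ring.
  - rewrite [LHS]fgliftB fgliftB fgliftZ -!/(g _) !gU /= Br.
    by rewrite /GRing.scale /=; ring.
  - by rewrite gU Bvv.
rewrite -(big_morph _ ext_square_piD ext_square_pi0) -ext_square_pi0.
move=> /wedge_relationP.
rewrite subr0 => /g_rel; rewrite (big_morph g gD g0) => {2}<-.
by apply: eq_bigr => i _; rewrite gU.
Qed.

End Wedge.

(** * The surface made of slit squares *)

Section Vec2.
Variable R : realType.

Lemma vec2_0 (x y : R) : vec2 x y 0 0 = x. Proof. by rewrite mxE. Qed.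

Lemma vec2_1 (x y : R) : vec2 x y 0 1 = y. Proof. by rewrite mxE. Qed.

Lemma vec2_eta (v : 'rV[R]_2) : vec2 (v 0 0) (v 0 1) = v.
Proof.
apply/rowP=> j; rewrite mxE; case: j => -[|[|//]] lt_j /=; congr (v _ _);
by apply: val_inj.
Qed.

Lemma vec2D (x y x' y' : R) : vec2 x y + vec2 x' y' = vec2 (x + x') (y + y').
Proof. by rewrite -[LHS]vec2_eta !mxE. Qed.

Lemma vec2N (x y : R) : - vec2 x y = vec2 (- x) (- y).
Proof. by rewrite -[LHS]vec2_eta !mxE. Qed.

Lemma vec2Z (l x y : R) : l *: vec2 x y = vec2 (l * x) (l * y).
Proof. by rewrite -[LHS]vec2_eta !mxE. Qed.

Definition vec2E := (vec2_0, vec2_1, vec2D, vec2N, vec2Z).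

End Vec2.

Lemma I3_ind (P : 'I_3 -> Prop) : P 0 -> P 1 -> P 2%:R -> forall i, P i.
Proof.
move=> P0 P1 P2 [[|[|[|//]]] lt_i].
- by rewrite (_ : Ordinal lt_i = 0) //; apply: val_inj.
- by rewrite (_ : Ordinal lt_i = 1) //; apply: val_inj.
- by rewrite (_ : Ordinal lt_i = 2%:R) //; apply: val_inj.
Qed.

Section Gluing.
Variables (R : realType) (S : translation_surface R).

Lemma glue_point_sym (p q : face S * 'rV[R]_2) : glue_point p q -> glue_point q p.
Proof.
(* Glued sides run in opposite directions, so the parameter l becomes 1 - l. *)
move=> [e [l [l01 -> ->]]]; exists (Defs.glue e), (1 - l).
have corner_ordS (d : face S * 'I_3) :
    corner d.1 (ordS d.2) = corner d.1 d.2 + side d.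
  by rewrite addrC subrK.
split.
- by rewrite subr_ge0 lerBlDr lerDl andbC.
- rewrite corner_ordS -addrA; congr (_, _ + _).
  by rewrite side_glue scalerBl scale1r scalerN opprK.
- rewrite glue_involutive corner_ordS -addrA; congr (_, _ + _).
  by rewrite side_glue scalerBl scale1r scalerN opprK addrA subrr add0r.
Qed.

Lemma chart_eq (p q : face S * 'rV[R]_2) :
  chart p.1 p.2 = chart q.1 q.2 <-> same_point p q.
Proof.
case: p q => t x [t' x'] /=; split=> [E|E].
  have : chart t' x' (t', x') by exact: rst_refl.
  by rewrite -E.
rewrite eqEsubset; split=> z tz; first exact: rst_trans (rst_sym _ _ _ _ E) tz.
exact: rst_trans E tz.
Qed.

End Gluing.

Section SlitSquares.
Variables (R : realType) (n : nat) (a : 'I_n.+1 -> R) (eps : R).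
Hypotheses (eps_gt0 : 0 < eps) (eps_lt : forall k, eps < a k).

Let a_gt0 k : 0 < a k. Proof. exact: lt_trans (eps_lt k). Qed.

(* The triangle ((k, r), u) is the half of the rectangle r of the square k
   below (u = false) or above (u = true) the diagonal; the line x = eps cuts
   the square [0, a k]^2 into the rectangles r = false and r = true. *)
Definition sq_face : finType := ('I_n.+1 * bool * bool)%type.

Definition rect_left (r : bool) : R := if r then eps else 0.
Definition rect_right (k : 'I_n.+1) (r : bool) : R := if r then a k else eps.
Definition rect_width k r := rect_right k r - rect_left r.

(** Sides 0, 1, 2 are horizontal, vertical and diagonal. The upper triangle is the lower one turned
    by half a turn about the centre of the rectangle. *)
Definition sq_corner (t : sq_face) (i : 'I_3) : 'rV[R]_2 :=
  let: ((k, r), u) := t in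
  vec2 (if (i == 0 :> nat) (+) u then rect_left r else rect_right k r)
       (if (i == 2 :> nat) (+) u then a k else 0).

(** Side 2 is glued across the diagonal, and side 1 to the other rectangle of the same square, both
    along x = eps and along the outer vertical sides. Side 0 joins top and bottom, within one square
    for the right rectangle, but from square k to the cyclically next one for the left rectangle:
    this is the slit. *)
Definition sq_glue (e : sq_face * 'I_3) : sq_face * 'I_3 :=
  let: (((k, r), u), i) := e in
  (((if (i == 0 :> nat) && ~~ r then if u then ordS k else ord_pred k else k,
     if i == 1 :> nat then ~~ r else r), ~~ u), i).

Definition sq_side (e : sq_face * 'I_3) :=
  sq_corner e.1 (ordS e.2) - sq_corner e.1 e.2.

Definition osign (u : bool) (x : R) : R := if u then - x else x.

Lemma sq_side0 k r u : sq_side (((k, r), u), 0) = vec2 (osign u (rect_width k r)) 0.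
Proof.
by rewrite /sq_side /= !vec2E /rect_width; case: u => /=; congr vec2; ring. Qed.

Lemma sq_side1 k r u : sq_side (((k, r), u), 1) = vec2 0 (osign u (a k)).
Proof. by rewrite /sq_side /= !vec2E; case: u => /=; congr vec2; ring. Qed.

Lemma sq_side2 k r u : sq_side (((k, r), u), 2%:R) =
  vec2 (- osign u (rect_width k r)) (- osign u (a k)).
Proof.
by rewrite /sq_side /= !vec2E /rect_width; case: u => /=; congr vec2; ring.
Qed.

Definition sq_sideE := (sq_side0, sq_side1, sq_side2).

Lemma rect_width_gt0 k r : 0 < rect_width k r.
Proof. by rewrite /rect_width; case: r; rewrite /= ?subr0 // subr_gt0. Qed.

Lemma sq_ccw t : 0 < det2 (sq_side (t, 0)) (sq_side (t, 1)).
Proof.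
case: t => -[k r] u; rewrite !sq_sideE /det2 !vec2E mul0r subr0.
by case: u; rewrite /= ?mulrNN mulr_gt0 // rect_width_gt0.
Qed.

Lemma sq_glueK : involutive sq_glue.
Proof.
move=> [[[k r] u]]; elim/I3_ind; case: r; case: u => //=;
by rewrite ?ordSK ?ord_predK.
Qed.

Lemma sq_side_glue e : sq_side (sq_glue e) = - sq_side e.
Proof.
case: e => -[[k r] u]; elim/I3_ind; rewrite !sq_sideE !vec2N;
  case: r; case: u => /=; rewrite ?oppr0 ?opprK ?subr0 //.
Qed.

Lemma sq_connected t t' :
  connect [rel s s' | [exists i, (sq_glue (s, i)).1 == s']] t t'.
Proof.
set e := [rel s s' | _].
have e_sym : connect_sym e.
  apply: sym_connect_sym => s s'; apply/existsP/existsP => -[i /eqP <-];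
  case def_g : (sq_glue (_, i)) => [s1 j]; exists j; by rewrite -def_g sq_glueK.
have step s i : connect e s (sq_glue (s, i)).1.
  by apply: connect1; apply/existsP; exists i.
have to_LL k r u : connect e ((k, false), false) ((k, r), u).
  have LU : connect e ((k, false), false) ((k, false), true).
    exact: (step _ 2%:R).
  have RU : connect e ((k, false), false) ((k, true), true).
    exact: (step _ 1).
  case: r; case: u => //.
  exact: connect_trans RU (step ((k, true), true) 2%:R).
(* The squares are reached in increasing order, each through the slit at the top of the preceding
   one; [ordS] does not wrap around on the way. *)
have to_k k : connect e ((ord0, false), false) ((k, false), false).
  case: k => m lt_m; elim: m lt_m => [|m IH] lt_m.
    by rewrite (_ : Ordinal lt_m = ord0) ?connect0 //; apply: val_inj.
  have lt_m' := ltnW lt_m; apply: connect_trans (IH lt_m') _.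
  apply: connect_trans (to_LL _ false true) _.
  rewrite (_ : Ordinal lt_m = ordS (Ordinal lt_m')); first exact: (step _ 0).
  by apply: val_inj; rewrite /= modn_small.
case: t => -[k r] u; case: t' => -[k' r'] u'.
rewrite e_sym; apply: (@connect_trans _ _ ((ord0, false), false)).
  rewrite e_sym; exact: connect_trans (to_k k') (to_LL _ _ _).
exact: connect_trans (to_k k) (to_LL _ _ _).
Qed.

Lemma sq_face_nonempty : (0 < #|sq_face|)%N.
Proof. by apply/card_gt0P; exists ((ord0, false), false). Qed.

Definition slit_squares : translation_surface R :=
  @TranslationSurface R sq_face sq_corner sq_glue sq_ccw sq_glueK sq_side_glue
    sq_face_nonempty sq_connected.

Local Notation S := slit_squares.

(** The two triangles of a rectangle contribute equally, their signs cancelling, and the widths of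
    the two rectangles add up to [a k]. The slits thus leave no trace in the invariant. *)
Lemma SAF_slit_squares (v : 'rV[R]_2) :
  SAF S v = (\sum_k wedge (a k * (- v 0 1 / norm2 v) : R^o)
                           (a k * (v 0 0 / norm2 v) : R^o)) *+ 2.
Proof.
have projx x : orth_proj v (vec2 x 0) = x * (- v 0 1 / norm2 v) :> R.
  by rewrite /orth_proj /dot2 /rot90 !vec2E mul0r addr0 mulrA.
have projy y : orth_proj v (vec2 0 y) = y * (v 0 0 / norm2 v) :> R.
  by rewrite /orth_proj /dot2 /rot90 !vec2E mul0r add0r mulrA.
pose F k r u := wedge (orth_proj v (sq_side ((k, r, u), 0)))
                      (orth_proj v (sq_side ((k, r, u), 1))).
transitivity (\sum_k \sum_(r : bool) \sum_(u : bool) F k r u).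
  rewrite (pair_bigA _ (fun k r => \sum_(u : bool) F k r u)).
  rewrite (pair_bigA _ (fun kr u => F kr.1 kr.2 u)).
  by rewrite SAF_sum; apply: eq_bigr => -[[k r] u].
rewrite -sumrMnl; apply: eq_bigr => k _.
rewrite !big_bool /F /= !sq_sideE /= !projx !projy !mulNr !wedgeNl !wedgeNr !opprK.
rewrite -!mulr2n -mulrnDl -wedgeDl; congr (wedge _ _ *+ 2).
by rewrite /rect_width /=; ring.
Qed.

(** * Points of the triangles, their identifications, and the decomposition into squares *)

Lemma triangle_lower k r (X Y : R) :
  triangle (((k, r), false) : face S) (vec2 X Y) <->
  [/\ 0 <= Y, X <= rect_right k r &
      rect_width k r * Y <= a k * (X - rect_left r)].
Proof.
have wgt0 := rect_width_gt0 k r.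
have E i : det2 (@side R S ((k, r), false, i))
    (vec2 X Y - @corner R S ((k, r), false) i) =
    det2 (sq_side ((k, r), false, i)) (vec2 X Y - sq_corner ((k, r), false) i).
  by [].
have E0 : det2 (@side R S ((k, r), false, 0))
    (vec2 X Y - @corner R S ((k, r), false) 0) = rect_width k r * Y.
  by rewrite E sq_sideE /= /det2 !vec2E; ring.
have E1 : det2 (@side R S ((k, r), false, 1))
    (vec2 X Y - @corner R S ((k, r), false) 1) = a k * (rect_right k r - X).
  by rewrite E sq_sideE /= /det2 !vec2E; ring.
have E2 : det2 (@side R S ((k, r), false, 2%:R))
    (vec2 X Y - @corner R S ((k, r), false) 2%:R) =
    a k * (X - rect_left r) - rect_width k r * Y.
  by rewrite E sq_sideE /= /det2 !vec2E /rect_width; ring.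
split=> [xt|[Y0 X1 D]].
  have := (xt 0, xt 1, xt 2%:R).
  by rewrite E0 E1 E2 !pmulr_rge0 // !subr_ge0 => -[[]].
by apply: I3_ind; rewrite ?E0 ?E1 ?E2 ?pmulr_rge0 ?subr_ge0.
Qed.

Lemma triangle_upper k r (X Y : R) :
  triangle (((k, r), true) : face S) (vec2 X Y) <->
  [/\ Y <= a k, rect_left r <= X &
      a k * (X - rect_left r) <= rect_width k r * Y].
Proof.
have wgt0 := rect_width_gt0 k r.
have E i : det2 (@side R S ((k, r), true, i))
    (vec2 X Y - @corner R S ((k, r), true) i) =
    det2 (sq_side ((k, r), true, i)) (vec2 X Y - sq_corner ((k, r), true) i).
  by [].
have E0 : det2 (@side R S ((k, r), true, 0))
    (vec2 X Y - @corner R S ((k, r), true) 0) = rect_width k r * (a k - Y).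
  by rewrite E sq_sideE /= /det2 !vec2E; ring.
have E1 : det2 (@side R S ((k, r), true, 1))
    (vec2 X Y - @corner R S ((k, r), true) 1) = a k * (X - rect_left r).
  by rewrite E sq_sideE /= /det2 !vec2E; ring.
have E2 : det2 (@side R S ((k, r), true, 2%:R))
    (vec2 X Y - @corner R S ((k, r), true) 2%:R) =
    rect_width k r * Y - a k * (X - rect_left r).
  by rewrite E sq_sideE /= /det2 !vec2E /rect_width; ring.
split=> [xt|[Y0 X1 D]].
  have := (xt 0, xt 1, xt 2%:R).
  by rewrite E0 E1 E2 !pmulr_rge0 // !subr_ge0 => -[[]].
by apply: I3_ind; rewrite ?E0 ?E1 ?E2 ?pmulr_rge0 ?subr_ge0.
Qed.

Lemma triangle_rect k r u (X Y : R) :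
  triangle (((k, r), u) : face S) (vec2 X Y) ->
  (rect_left r <= X <= rect_right k r) && (0 <= Y <= a k).
Proof.
have wgt0 := rect_width_gt0 k r; have agt0 := a_gt0 k.
have rightE : rect_right k r = rect_left r + rect_width k r.
  by rewrite /rect_width addrC subrK.
case: u => [/triangle_upper|/triangle_lower] [Y_bd X_bd D];
  rewrite Y_bd X_bd ?andbT /=.
  have Y0 : 0 <= Y.
    by rewrite -(pmulr_rge0 _ wgt0) (le_trans _ D) // mulr_ge0 ?subr_ge0 // ltW.
  rewrite Y0 andbT rightE -lerBlDl -(ler_pM2l agt0) (le_trans D) //.
  by rewrite mulrC ler_pM2r.
have X0 : rect_left r <= X.
  by rewrite -subr_ge0 -(pmulr_rge0 _ agt0) (le_trans _ D) // mulr_ge0 // ltW.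
rewrite X0 /= -(ler_pM2l wgt0) (le_trans D) // mulrC ler_pM2r //.
by rewrite lerBlDl -rightE.
Qed.

Lemma rect_triangle k r (X Y : R) :
  rect_left r <= X <= rect_right k r -> 0 <= Y <= a k ->
  exists u, triangle (((k, r), u) : face S) (vec2 X Y).
Proof.
move=> /andP[X0 X1] /andP[Y0 Y1].
have [D|/ltW D] := leP (rect_width k r * Y) (a k * (X - rect_left r)).
  by exists false; apply/triangle_lower.
by exists true; apply/triangle_upper.
Qed.

Lemma same_diagonal k r (X Y : R) :
  triangle (((k, r), false) : face S) (vec2 X Y) ->
  triangle (((k, r), true) : face S) (vec2 X Y) ->
  same_point (((k, r), false) : face S, vec2 X Y) (((k, r), true), vec2 X Y).
Proof.
move=> /triangle_lower[Y0 _ D] /triangle_upper[Y1 _ D'].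
have agt0 := a_gt0 k; have a_neq0 := lt0r_neq0 agt0.
have {D D'} XE : X = rect_left r + rect_width k r * Y / a k.
  have {D' D} D : a k * (X - rect_left r) = rect_width k r * Y.
    by apply/eqP; rewrite eq_le D D'.
  by rewrite -D; field.
(* Side 2 of the lower triangle descends from the upper right corner, so height Y has parameter 1 -
   Y / a k. *)
apply: rst_step; exists ((k, r), false, 2%:R), (1 - Y / a k); split.
- rewrite subr_ge0 lerBlDr lerDl ler_pdivrMr // mul1r Y1.
  by rewrite divr_ge0 // ltW.
- rewrite -[@side _ _ _]/(sq_side _) sq_sideE /= !vec2E XE /rect_width.
  by congr (_, vec2 _ _); field.
- rewrite -[@side _ _ _]/(sq_side _) sq_sideE /= !vec2E XE /rect_width.
  by congr (_, vec2 _ _); field.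
Qed.

Lemma same_rect k r u u' (X Y : R) :
  triangle (((k, r), u) : face S) (vec2 X Y) ->
  triangle (((k, r), u') : face S) (vec2 X Y) ->
  same_point (((k, r), u) : face S, vec2 X Y) (((k, r), u'), vec2 X Y).
Proof.
case: u; case: u' => xt xt'; try exact: rst_refl; last exact: same_diagonal.
by apply: rst_sym; exact: same_diagonal.
Qed.

(** A common point has X = eps. The chain passes through the lower left and the upper right
    triangles, which share that side. *)
Lemma same_slit k u u' (X Y : R) :
  triangle (((k, false), u) : face S) (vec2 X Y) ->
  triangle (((k, true), u') : face S) (vec2 X Y) ->
  same_point (((k, false), u) : face S, vec2 X Y) (((k, true), u'), vec2 X Y).
Proof.
move=> xt xt'; have agt0 := a_gt0 k; have a_neq0 := lt0r_neq0 agt0.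
have /andP[/andP[_ X1] /andP[Y0 Y1]] := triangle_rect xt.
have /andP[/andP[X0 _] _] := triangle_rect xt'.
have XE : X = eps by apply/eqP; rewrite eq_le X0 X1.
rewrite {X X0 X1}XE in xt xt' *.
apply: rst_trans; first apply: (same_rect (u' := false) xt).
  apply/triangle_lower; rewrite /rect_width /= subr0 lexx Y0 mulrC.
  by split=> //; rewrite ler_pM2r.
apply: rst_trans; last apply: (same_rect (u := true) _ xt').
  apply: rst_step; exists ((k, false), false, 1), (Y / a k); split.
  - by rewrite divr_ge0 ?(ltW agt0) //= ler_pdivrMr // mul1r.
  - rewrite -[@side _ _ _]/(sq_side _) sq_sideE /= !vec2E.
    by congr (_, vec2 _ _); field.
  - rewrite -[@side _ _ _]/(sq_side _) sq_sideE /= !vec2E.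
    by congr (_, vec2 _ _); field.
apply/triangle_upper; rewrite /rect_width /= lexx Y1 subrr mulr0.
by split=> //; rewrite mulr_ge0 // subr_ge0 ltW.
Qed.

Lemma same_square k r r' u u' (X Y : R) :
  triangle (((k, r), u) : face S) (vec2 X Y) ->
  triangle (((k, r'), u') : face S) (vec2 X Y) ->
  same_point (((k, r), u) : face S, vec2 X Y) (((k, r'), u'), vec2 X Y).
Proof.
case: r; case: r' => xt xt'; try exact: same_rect; last exact: same_slit.
by apply: rst_sym; exact: same_slit.
Qed.

(** Sides on the boundary of the square are excluded by the strict bounds, and gluing across a
    diagonal or the line x = eps keeps both the square and the coordinates. *)
Lemma glue_interior (t : face S) (X Y : R) (q : face S * 'rV[R]_2) :
  0 < X < a t.1.1 -> 0 < Y < a t.1.1 -> glue_point (t, vec2 X Y) q ->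
  q.1.1.1 = t.1.1 /\ q.2 = vec2 X Y.
Proof.
move=> X_bd Y_bd [[[[k r] u] i] [l [_ [t_def xy_def] ->]]].
have {xy_def} := congr1 (fun v : 'rV[R]_2 => (v 0 0, v 0 1)) xy_def.
rewrite {t}t_def -[@side _ _ _]/(sq_side _) /= in X_bd Y_bd *.
elim/I3_ind: i; rewrite sq_sideE /= !vec2E ?mulr0 ?addr0 ?add0r => -[X_def Y_def];
  rewrite {X}X_def {Y}Y_def in X_bd Y_bd *.
- by move: Y_bd; clear; case: u; rewrite /= ltxx ?andbF.
- by move: X_bd; clear; case: r; case: u => /=; rewrite /= ?ltxx ?andbF //; split;
    rewrite ?vec2E ?mulr0 ?addr0.
- by clear; case: u.
Qed.

(** Gives the disjointness of the open squares. The form of an equivalence lets the induction pass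
    through symmetry and transitivity. *)
Lemma same_interior (p q : face S * 'rV[R]_2) (k : 'I_n.+1) (X Y : R) :
    0 < X < a k -> 0 < Y < a k -> same_point p q ->
  (p.1.1.1 = k /\ p.2 = vec2 X Y) <-> (q.1.1.1 = k /\ q.2 = vec2 X Y).
Proof.
move=> X_bd Y_bd; elim=> {p q} [p q pq|//|p q _ -> //|p q r _ -> _ ->] //.
have step (p' q' : face S * 'rV[R]_2) :
    glue_point p' q' -> p'.1.1.1 = k /\ p'.2 = vec2 X Y ->
    q'.1.1.1 = k /\ q'.2 = vec2 X Y.
  case: p' => t v pq' [/= def_k def_v]; rewrite {}def_v -{}def_k in X_bd Y_bd pq' *.
  exact: glue_interior pq'.
by split; apply: step => //; exact: glue_point_sym.
Qed.

Lemma closed_squareP (k : 'I_n.+1) (x : 'rV[R]_2) :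
  closed_square 0 (vec2 (a k) 0) x <-> 0 <= x 0 0 <= a k /\ 0 <= x 0 1 <= a k.
Proof.
have agt0 := a_gt0 k; have a_neq0 := lt0r_neq0 agt0.
split=> [[b [c [/andP[b0 b1] /andP[c0 c1] ->]]]|[/andP[x0 x1] /andP[y0 y1]]].
  rewrite /rot90 !vec2E add0r !vec2E; split; nra.
exists (x 0 0 / a k), (x 0 1 / a k).
split; rewrite ?divr_ge0 ?(ltW agt0) // ?ler_pdivrMr // ?mul1r //.
rewrite /rot90 !vec2E add0r !vec2E -[LHS]vec2_eta; congr vec2; field; exact: a_neq0.
Qed.

Lemma open_squareP (k : 'I_n.+1) (x : 'rV[R]_2) :
  open_square 0 (vec2 (a k) 0) x -> 0 < x 0 0 < a k /\ 0 < x 0 1 < a k.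
Proof.
have agt0 := a_gt0 k.
move=> [b [c [/andP[b0 b1] /andP[c0 c1] ->]]].
rewrite /rot90 !vec2E add0r !vec2E; split; nra.
Qed.

Lemma slit_squares_decompose : decomposes_into_squares S.
Proof.
(* Defined without choosing a triangle that contains x; by [same_square] all choices give the same
   chart. *)
pose f k x : set (face S * 'rV[R]_2) :=
  [set q | exists r u : bool, triangle (((k, r), u) : face S) x /\
                       same_point (((k, r), u) : face S, x) q].
have fE k r u x : triangle (((k, r), u) : face S) x ->
    f k x = chart (((k, r), u) : face S) x.
  rewrite -(vec2_eta x) => xt; rewrite eqEsubset; split=> q.
    by move=> [r' [u' [xt' tq]]]; exact: rst_trans (same_square xt xt') tq.
  by move=> tq; exists r, u.
have cover k x : closed_square 0 (vec2 (a k) 0) x ->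
    exists r u : bool, triangle (((k, r), u) : face S) x.
  move=> /closed_squareP[/andP[X0 X1] Y_bd]; rewrite -[x]vec2_eta.
  have [Xe|/ltW eX] := leP (x 0 0) eps.
    by exists false; apply: rect_triangle; rewrite //= X0.
  by exists true; apply: rect_triangle; rewrite //= eX.
have sub_square k r u x : triangle (((k, r), u) : face S) x ->
    closed_square 0 (vec2 (a k) 0) x.
  rewrite -[x]vec2_eta => /triangle_rect/andP[/andP[X0 X1] Y_bd].
  apply/closed_squareP; rewrite !vec2E Y_bd; split=> //.
  have := eps_lt k; have := eps_gt0; move: X0 X1; case: r; rewrite /=; lra.
(* All squares have their corner at the origin and differ by their maps [f k]; the pieces of each
   are its four triangles, untranslated. *)
exists n.+1, (fun _ => 0), (fun k => vec2 (a k) 0), f; split.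
- move=> k; apply/eqP => /(congr1 (fun v : 'rV[R]_2 => v 0 0)).
  by rewrite vec2E mxE => /eqP; rewrite gt_eqF.
- move=> k; exists [seq (((k, ru.1), ru.2), 0) | ru <- enum {: bool * bool}].
  split=> [x /cover[r [u xt]]|x m _ /mapP[[r u] _ ->]] /=.
    exists (((k, r), u), 0); rewrite ?subr0 //=.
    by apply/mapP; exists (r, u); rewrite ?mem_enum.
  by rewrite subr0; exact: fE.
- move=> _ [[[k r] u] [x [xt ->]]]; exists k, x; split; last exact: fE.
  exact: sub_square xt.
- move=> k k' x x' /open_squareP[X_bd Y_bd] /open_squareP[X'_bd Y'_bd].
  have [|r [u xt]] := cover k x.
    by apply/closed_squareP; split; apply/andP; split; lra.
  have [|r' [u' xt']] := cover k' x'.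
    by apply/closed_squareP; split; apply/andP; split; lra.
  rewrite (fE _ _ _ _ xt) (fE _ _ _ _ xt').
  move=> /(chart_eq (((k, r), u) : face S, x) (((k', r'), u') : face S, x')).
  move=> /(same_interior X_bd Y_bd).
  by case=> -[//|]; rewrite ?vec2_eta //= => -> ->.
Qed.

End SlitSquares.

(** * Periodic directions *)

Section CasimirWedge.
Variables (R : realType) (K : fieldExtType rat) (iota : {rmorphism K -> R}).
Variables (T : {scalar K}) (A : seq K).
Hypothesis T_pos : forall x, x != 0 -> 0 < T (x * x).
Hypothesis A_pos : {in A, forall a, 0 < iota a}.
Hypothesis casimir : forall x, x = \sum_(a <- A) T (x * a) *: a.

Lemma iotaZ q x : iota (q *: x) = ratr q * iota x.
Proof.
rewrite -[q *: x]mul1r -scalerAr scalerAl rmorphM; congr (_ * _).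
exact: (fmorph_eq_rat (iota \o in_alg K)).
Qed.

(* The coefficients [T (q a a')] are symmetric in [a] and [a'], whereas
   [a /\ a'] is antisymmetric. *)
Lemma casimir_wedge_eq0 (q : K) (c : R) :
  (\sum_(a <- A) wedge (iota a * (iota q * c) : R^o) (iota a * c : R^o)) *+ 2 = 0.
Proof.
set S := \sum_(a <- A) _.
pose w (q : rat) a a' := wedge (ratr q *: (iota a * c : R^o)) (iota a' * c : R^o).
have SE : S = \sum_(a <- A) \sum_(a' <- A) w (T (q * a * a')) a' a.
  apply: eq_bigr => a _; rewrite -wedge_suml; congr wedge.
  rewrite mulrCA mulrA -rmorphM {1}(casimir (q * a)) rmorph_sum mulr_suml.
  by apply: eq_bigr => a' _; rewrite /= iotaZ /GRing.scale /= mulrA.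
(* The factor 2 in the SAF-invariant makes antisymmetry sufficient. *)
suff SN : S = - S by rewrite mulr2n {1}SN addNr.
rewrite {1}SE SE [LHS]exchange_big -sumrN; apply: eq_bigr => a _ /=.
rewrite -sumrN; apply: eq_bigr => a' _.
by rewrite /w [LHS]wedgeC wedgeZlr mulrAC.
Qed.

(** With phi and psi dual to s and c, the form [B] takes the value [T (a * a) > 0] on the term of
    each a. *)
Lemma casimir_wedge_neq0 (s c : R) : A != [::] -> c != 0 ->
    (forall q, s != iota q * c) ->
  (\sum_(a <- A) wedge (iota a * s : R^o) (iota a * c : R^o)) *+ 2 != 0.
Proof.
move=> A_neq0 c_neq0 sc.
(* The functional psi, with the roles of s and c exchanged, needs independence in this direction
   too. *)
have cs q : c != iota q * s.
  apply/eqP=> qs; have q_neq0 : q != 0.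
    by apply: contraNneq c_neq0 => q0; rewrite qs q0 rmorph0 mul0r.
  by have := sc q^-1; rewrite qs fmorphV mulKf ?fmorph_eq0 ?eqxx.
have [phi [phi_lin phi_c phi_s]] := separating_functional sc.
have [psi [psi_lin psi_s psi_c]] := separating_functional cs.
pose B (x y : R^o) : rat := T (phi x * psi y - psi x * phi y).
have ratrE (q : rat) : ratr q = iota q%:A.
  by rewrite iotaZ rmorph1 mulr1.
have scaled (h : R -> K) k x : (forall k x y, h (iota k * x + y) = k * h x + h y) ->
    h (iota k * x) = k * h x.
  move=> h_lin; have h0 : h 0 = 0.
    apply: (addIr (h 0)); have := h_lin 1 0 0.
    by rewrite mulr0 mul1r addr0 add0r => <-.
  by rewrite -[X in h X]addr0 h_lin h0 addr0.
(* Doubling is written as a sum over [A ++ A], to which [wedge_sum_eq0] applies. *)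
apply/negP; rewrite mulr2n -big_cat => /eqP /(wedge_sum_eq0 (B := B)) B_eq0.
have : 0 < \sum_(a <- A ++ A) B (iota a * s) (iota a * c).
  have B_gt0 a : a \in A ++ A -> 0 < B (iota a * s) (iota a * c).
    rewrite mem_cat orbb => /A_pos a_gt0.
    rewrite /B !scaled // phi_s phi_c psi_s psi_c.
    rewrite !mulr1 !mulr0 subr0 T_pos //.
    by apply: contraTneq a_gt0 => ->; rewrite rmorph0 ltxx.
  case: (A ++ A) B_gt0 (cat_nilp A A) => [_ /esym/andP[/nilP A0]|a A' B_gt0 _].
    by rewrite A0 in A_neq0.
  rewrite big_cons ltr_pwDl ?B_gt0 ?mem_head // big_seq sumr_ge0 // => a' a'A.
  by rewrite ltW ?B_gt0 // inE a'A orbT.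
rewrite B_eq0 ?ltxx //.
- move=> q x y z; rewrite /B /GRing.scale /= ratrE phi_lin psi_lin.
  rewrite -linearZ -linearD /=; congr (T _).
  rewrite -[q *: (_ - _)]mulr_algl.
  move: (q%:A) (phi x) (phi y) (phi z) (psi x) (psi y) (psi z).
  by move=> *; ring.
- move=> q x y z; rewrite /B /GRing.scale /= ratrE phi_lin psi_lin.
  rewrite -linearZ -linearD /=; congr (T _).
  rewrite -[q *: (_ - _)]mulr_algl.
  move: (q%:A) (phi x) (phi y) (phi z) (psi x) (psi y) (psi z).
  by move=> *; ring.
- by move=> x; rewrite /B mulrC subrr linear0.
Qed.

End CasimirWedge.

Lemma norm2_gt0 (R : realType) (v : 'rV[R]_2) : v != 0 -> 0 < norm2 v.
Proof.
move=> v_neq0; rewrite sqrtr_gt0 lt_def andbC addr_ge0 -?expr2 ?sqr_ge0 //=.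
apply: contra v_neq0; rewrite paddr_eq0 ?sqr_ge0 // !sqrf_eq0.
move=> /andP[/eqP v0 /eqP v1].
by rewrite -(vec2_eta v) v0 v1 -(scale0r (vec2 0 0)) vec2Z mul0r.
Qed.

(** * From the periodic directions to the periodic direction field *)

Section DirectionField.
Variables (R : realType) (K : fieldExtType rat) (iota : {rmorphism K -> R}).

(** For nonzero v this says that the slope is infinite or lies in the image of K. *)
Definition K_direction (v : 'rV[R]_2) : Prop :=
  exists (r : R) (x y : K), v = vec2 (r * iota x) (r * iota y).

Variable S : translation_surface R.
Hypothesis S_periodic : forall v : 'rV[R]_2,
  algebraically_periodic S v <-> v != 0 /\ K_direction v.

(** The rows p and w of [invmx g] and their sum are K-directions, so up to one common real factor r
    the matrix has entries in K. Hence p + s w is a K-direction exactly when s is in K. *)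
Lemma K_directions_direction_field : is_periodic_direction_field S (range iota).
Proof.
have vec2_eq0 (x y : R) : (vec2 x y == 0) = (x == 0) && (y == 0).
  apply/eqP/andP => [v0|[/eqP-> /eqP->]].
    by rewrite -(vec2_0 x y) -{2}(vec2_1 x y) v0 !mxE.
  by rewrite -(scale0r (vec2 0 0)) vec2Z mul0r.
have per (x y : K) : (x != 0) || (y != 0) ->
    algebraically_periodic S (vec2 (iota x) (iota y)).
  move=> xy; apply/S_periodic; split; last by exists 1, x, y; rewrite !mul1r.
  by rewrite vec2_eq0 !fmorph_eq0 negb_and.
split.
  exists (vec2 (iota 1) (iota 0)), (vec2 (iota 0) (iota 1)),
    (vec2 (iota 1) (iota 1)).
  split; first by split; apply: per; rewrite oner_eq0 ?orbT.
  by rewrite /det2 !vec2E !rmorph1 !rmorph0 !(mulr0, mul0r, mulr1) !(subr0, sub0r)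
    oppr_eq0 oner_eq0.
move=> g g_unit.
pose p := row 0 (invmx g); pose w := row 1 (invmx g).
have sum2 (F : 'I_2 -> R) : \sum_i F i = F 0 + F 1.
  by rewrite !big_ord_recl big_ord0 addr0; congr (_ + F _); apply: val_inj.
have slopeE s : slope_vector g s = vec2 (p 0 0 + s * w 0 0) (p 0 1 + s * w 0 1).
  by rewrite -[LHS]vec2_eta !mxE !sum2 !vec2E !mul1r.
have vertE : vertical_vector g = vec2 (w 0 0) (w 0 1).
  by rewrite -[LHS]vec2_eta !mxE !sum2 !vec2E !mul1r !mul0r !add0r.
have det_neq0 : p 0 0 * w 0 1 - p 0 1 * w 0 0 != 0.
  have : \det (invmx g) != 0 by rewrite -unitfE -unitmxE unitmx_inv.
  rewrite (expand_det_row _ 0) sum2 /cofactor !det_mx11 !mxE /=.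
  have -> : fintype.lift (0 : 'I_2) (0 : 'I_1) = 1 by apply: val_inj.
  have -> : fintype.lift (1 : 'I_2) (0 : 'I_1) = 0 by apply: val_inj.
  by rewrite expr0 expr1 mul1r mulN1r mulrN.
clearbody p w.
rewrite vertE !slopeE !mul0r !addr0 !mul1r.
move: (p 0 0) (p 0 1) (w 0 0) (w 0 1) det_neq0 slopeE {vertE} => p0 p1 w0 w1.
move=> det_neq0 slopeE.
move=> /S_periodic[p_neq0 [r0 [x0 [y0 p_def]]]].
move=> /S_periodic[pw_neq0 [r [x [y pw_def]]]].
move=> /S_periodic[w_neq0 [r1 [x1 [y1 w_def]]]].
have vec2I (a b c d : R) : vec2 a b = vec2 c d -> a = c /\ b = d.
  by move=> E; rewrite -(vec2_0 a b) -{2}(vec2_1 a b) E !vec2E.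
have [p0E p1E] := vec2I _ _ _ _ p_def.
have [w0E w1E] := vec2I _ _ _ _ w_def.
have [q0E q1E] := vec2I _ _ _ _ pw_def.
have dt : x0 * y1 - y0 * x1 != 0.
  apply: contraNneq det_neq0 => /(congr1 iota).
  rewrite rmorphB !rmorphM rmorph0 => dt0; rewrite p0E p1E w0E w1E.
  by apply/eqP; transitivity (r0 * r1 * 0); [rewrite -dt0|]; ring.
set d := x0 * y1 - y0 * x1 in dt.
have iota_d : iota d = iota x0 * iota y1 - iota y0 * iota x1.
  by rewrite rmorphB !rmorphM.
have d_neq0 : iota d != 0 by rewrite fmorph_eq0.
(* Cramer's rule for r (x, y) = r0 (x0, y0) + r1 (x1, y1) gives r0 = r al and r1 = r be. *)
pose al := (x * y1 - y * x1) / d; pose be := (x0 * y - y0 * x) / d.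
have r0E : r0 = r * iota al.
  apply: (mulIf d_neq0); rewrite -mulrA -rmorphM divfK //.
  rewrite iota_d rmorphB !rmorphM.
  transitivity ((r * iota x) * iota y1 - (r * iota y) * iota x1); last by ring.
  by rewrite -q0E -q1E p0E p1E w0E w1E; ring.
have r1E : r1 = r * iota be.
  apply: (mulIf d_neq0); rewrite -mulrA -rmorphM divfK //.
  rewrite iota_d rmorphB !rmorphM.
  transitivity (iota x0 * (r * iota y) - iota y0 * (r * iota x)); last by ring.
  by rewrite -q0E -q1E p0E p1E w0E w1E; ring.
have r_neq0 : r != 0.
  by apply: contraNneq pw_neq0 => r_eq0; rewrite q0E q1E r_eq0 !mul0r vec2_eq0 eqxx.
have al_neq0 : al != 0.
  apply: contraNneq p_neq0 => al0.
  by rewrite p0E p1E r0E al0 rmorph0 mulr0 !mul0r vec2_eq0 eqxx.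
have be_neq0 : be != 0.
  apply: contraNneq w_neq0 => be0.
  by rewrite w0E w1E r1E be0 rmorph0 mulr0 !mul0r vec2_eq0 eqxx.
clearbody al be; rewrite eqEsubset; split=> s.
  rewrite /periodic_slopes /= slopeE => /S_periodic[v_neq0 [r' [x' [y' v_def]]]].
  have [v0E v1E] := vec2I _ _ _ _ v_def.
  (* That p + s w is parallel to (x', y') reads D0 + s D1 = 0 after division by r, so s = - D0 /
     D1. *)
  pose D0 := al * (x0 * y' - y0 * x'); pose D1 := be * (x1 * y' - y1 * x').
  have D_eq0 : iota D0 + s * iota D1 = 0.
    apply: (mulfI r_neq0); rewrite mulr0.
    have : (p0 + s * w0) * iota y' - (p1 + s * w1) * iota x' = 0.
      by rewrite v0E v1E; ring.
    rewrite p0E p1E w0E w1E r0E r1E => <-.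
    by rewrite /D0 /D1 !rmorphM !rmorphB !rmorphM; ring.
  (* If D1 = 0, then D0 = 0 as well, and (x', y') is parallel to two independent vectors, hence
     zero. *)
  have [D1_eq0|D1_neq0] := eqVneq D1 0.
    have D0_eq0 : D0 = 0.
      by apply/eqP; rewrite -(fmorph_eq0 iota) -D_eq0 D1_eq0 rmorph0 mulr0 addr0.
    have E0 : x0 * y' - y0 * x' = 0.
      by apply: (mulfI al_neq0); rewrite mulr0.
    have E1 : x1 * y' - y1 * x' = 0.
      by apply: (mulfI be_neq0); rewrite mulr0.
    have x'0 : x' = 0.
      apply: (mulfI dt); rewrite mulr0.
      by transitivity (x1 * 0 - x0 * 0 : K); [rewrite -{1}E0 -E1 /d|]; ring.
    have y'0 : y' = 0.
      apply: (mulfI dt); rewrite mulr0.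
      by transitivity (y1 * 0 - y0 * 0 : K); [rewrite -{1}E0 -E1 /d|]; ring.
    by move: v_neq0; rewrite v0E v1E x'0 y'0 rmorph0 mulr0 vec2_eq0 eqxx.
  exists (- D0 / D1) => //; rewrite rmorphM rmorphN fmorphV.
  apply: (mulIf (_ : iota D1 != 0)); first by rewrite fmorph_eq0.
  rewrite divfK ?fmorph_eq0 //; apply/eqP.
  by rewrite eq_sym -addr_eq0 addrC D_eq0.
move=> [q _ <-]; rewrite /periodic_slopes /= slopeE; apply/S_periodic; split.
  apply: contra det_neq0; rewrite vec2_eq0 => /andP[/eqP e0 /eqP e1].
  apply/eqP; transitivity ((p0 + iota q * w0) * w1 - (p1 + iota q * w1) * w0).
    by ring.
  by rewrite e0 e1 !mul0r subrr.
exists r, (al * x0 + q * (be * x1)), (al * y0 + q * (be * y1)).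
by rewrite !rmorphD !rmorphM p0E p1E w0E w1E r0E r1E; congr vec2; ring.
Qed.

End DirectionField.

(** * Periodic directions of the slit squares with sides in K *)

Section CasimirSurface.
Variables (R : realType) (K : fieldExtType rat) (iota : {rmorphism K -> R}).
Variables (T : {scalar K}) (n : nat) (A : n.+1.-tuple K) (e : K).
Hypothesis T_pos : forall x, x != 0 -> 0 < T (x * x).
Hypothesis A_pos : {in A, forall a, 0 < iota a}.
Hypothesis casimir : forall x, x = \sum_(a <- A) T (x * a) *: a.
Hypothesis e_gt0 : 0 < iota e.
Hypothesis e_lt : forall k, iota e < iota (tnth A k).

Local Notation S := (slit_squares e_gt0 e_lt).

(** Up to the norm, the invariant is the Casimir sum for s = - v 0 1 and c = v 0 0, and the two
    cases are whether s is in K c. The vertical direction c = 0 is treated apart. *)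
Lemma casimir_SAF_eq0 (v : 'rV[R]_2) : v != 0 ->
  SAF S v = 0 <-> K_direction iota v.
Proof.
move=> v_neq0; have v_norm := lt0r_neq0 (norm2_gt0 v_neq0).
rewrite SAF_slit_squares.
rewrite -(big_tuple _ _ A xpredT (fun a => wedge
  (iota a * (- v 0 1 / norm2 v) : R^o) (iota a * (v 0 0 / norm2 v) : R^o))).
split=> [SAF0|[r [x [y v_def]]]].
  have [v0|v0_neq0] := eqVneq (v 0 0) 0.
    by exists (v 0 1), 0, 1; rewrite rmorph0 rmorph1 mulr0 mulr1 -v0 vec2_eta.
  have c_neq0 : v 0 0 / norm2 v != 0 by rewrite mulf_neq0 ?invr_eq0.
  have [[q qE]|no_q] := pselect (exists q, - v 0 1 = iota q * v 0 0).
    exists (v 0 0), 1, (- q); rewrite -[LHS]vec2_eta rmorph1 mulr1; congr vec2.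
    by rewrite rmorphN mulrN mulrC -qE opprK.
  have A_neq0 : (A : seq K) != [::] by rewrite -size_eq0 size_tuple.
  have sc q : - v 0 1 / norm2 v != iota q * (v 0 0 / norm2 v).
    apply/eqP; rewrite mulrA => qE; apply: no_q; exists q.
    by apply: (mulIf _ qE); rewrite invr_eq0.
  by have := casimir_wedge_neq0 T_pos A_pos A_neq0 c_neq0 sc; rewrite SAF0 eqxx.
have [x0|x_neq0] := eqVneq x 0.
  rewrite big1 ?mul0rn // => a _.
  have -> : v 0 0 = 0 by rewrite v_def vec2E x0 rmorph0 mulr0.
  by rewrite mul0r mulr0; exact: wedge0r.
rewrite -[RHS](casimir_wedge_eq0 iota casimir (- y / x) (v 0 0 / norm2 v)).
congr (_ *+ 2); apply: eq_bigr => a _; congr wedge; congr (_ * _).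
rewrite v_def !vec2E -v_def rmorphM rmorphN fmorphV.
by field; rewrite v_norm fmorph_eq0.
Qed.

Lemma casimir_surface_periodic (v : 'rV[R]_2) :
  algebraically_periodic S v <-> v != 0 /\ K_direction iota v.
Proof.
by split=> -[v_neq0 SAF0]; split=> //; apply/casimir_SAF_eq0.
Qed.

(** Side lengths and slit length lie in K, hence so do the coordinates of every rational combination
    of sides. *)
Lemma casimir_surface_completely_periodic : completely_algebraically_periodic S.
Proof.
move=> v [c _ v_def] v_neq0; apply/casimir_surface_periodic; split=> //.
suff [x [y ->]] : exists x y, v = vec2 (iota x) (iota y).
  by exists 1, x, y; rewrite !mul1r.
rewrite v_def.
apply: (big_ind (fun u => exists x y, u = vec2 (iota x) (iota y))).
- by exists 0, 0; rewrite rmorph0 -(scale0r (vec2 0 0)) vec2Z mul0r.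
- move=> _ _ [x [y ->]] [x' [y' ->]].
  by exists (x + x'), (y + y'); rewrite vec2D !rmorphD.
move=> d _.
have cornerK t i : exists x y, @corner R S t i = vec2 (iota x) (iota y).
  case: t => -[k r] u /=.
  exists (if (i == 0 :> nat) (+) u then if r then e else 0
          else if r then tnth A k else e),
    (if (i == 2 :> nat) (+) u then tnth A k else 0).
  by congr vec2; case: ifP => _; rewrite ?rmorph0 //; case: r; rewrite ?rmorph0.
have [x [y xyE]] := cornerK d.1 d.2.
have [x' [y' xyE']] := cornerK d.1 (ordS d.2).
exists ((c d)%:A * (x' - x)), ((c d)%:A * (y' - y)).
rewrite /side xyE xyE' vec2N vec2D vec2Z !mulr_algl !iotaZ.
by rewrite !rmorphB.
Qed.

End CasimirSurface.

(** The inverse of 1 plus the sum of all a^-1 lies in K and is below each a. *)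
Lemma small_element (R : realFieldType) (K : fieldType) (iota : {rmorphism K -> R})
    (A : seq K) : {in A, forall a, 0 < iota a} ->
  exists e, 0 < iota e /\ {in A, forall a, iota e < iota a}.
Proof.
move=> A_pos; pose s := \sum_(a <- A) iota a^-1.
have term_gt0 a : a \in A -> 0 < iota a^-1.
  by move=> aA; rewrite fmorphV invr_gt0 A_pos.
have s_ge0 : 0 <= s by rewrite /s big_seq sumr_ge0 // => a /term_gt0/ltW.
exists (1 + \sum_(a <- A) a^-1)^-1; rewrite fmorphV rmorphD rmorph1 rmorph_sum -/s.
split=> [|a aA]; first by rewrite invr_gt0 ltr_pwDl.
rewrite -[ltRHS]invrK ltf_pV2 ?posrE ?invr_gt0 ?A_pos ?ltr_pwDl //.
rewrite -fmorphV /s (big_rem a) //=.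
rewrite lerDl big_seq sumr_ge0 //.
by move=> b /mem_rem/term_gt0/ltW.
Qed.

Unset Implicit Arguments.

Theorem theorem1p10 (R : realType) (K : fieldExtType rat)
    (iota : {rmorphism K -> R}) (K_totally_real : totally_real R K) :
  exists S : translation_surface R,
    [/\ completely_algebraically_periodic S,
        is_periodic_direction_field S (range iota) &
        decomposes_into_squares S].
Proof.
have [T T_pos] := totally_real_trace_form K_totally_real.
have [A [A_pos casimir]] := casimir_squares T_pos iota.
have [e [e_gt0 e_lt]] := small_element A_pos.
(* An empty A would give 1 = 0 in the Casimir identity; at least one square is needed to index by
   ['I_n.+1]. *)
case: A => [|a A] in A_pos casimir e_lt.
  by have := casimir 1; rewrite big_nil => /eqP; rewrite oner_eq0.
pose As : (size A).+1.-tuple K := in_tuple (a :: A).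
have e_lt' k : iota e < iota (tnth As k) by apply: e_lt; exact: mem_tnth.
exists (slit_squares (a := fun k => iota (tnth As k)) e_gt0 e_lt'); split.
- exact: (casimir_surface_completely_periodic (A := As) T_pos A_pos casimir).
- apply: K_directions_direction_field => v.
  exact: (casimir_surface_periodic (A := As) T_pos A_pos casimir).
- exact: slit_squares_decompose.
Qed.
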